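(* Consider the time-invariant system $\dot x(t)=f(x(t))$. Suppose that: (1) its solutions evolve on an invariant, compact and convex set $\Omega\subset\mathbb{R}^n$; (2) $f\in C^1$; and (3) the Jacobian matrix $J(x):=\frac{\partial}{\partial x}f(x)$ belongs to $\mathbb{M}^+$ for all $x\in\Omega$. Then for every $x_0\in\Omega$ the solution $x(t,x_0)$ with $x(0,x_0)=x_0$ converges, as $t\to\infty$, to an equilibrium point.
   Context: $\mathbb{M}^+\subset\mathbb{R}^{n\times n}$ denotes the set of tridiagonal matrices with positive entries on the sub-diagonal and the super-diagonal (the diagonal entries are arbitrary real numbers). Invariance of $\Omega$ means that for any $x_0\in\Omega$ a unique solution $x(t,x_0)$ exists and satisfies $x(t,x_0)\in\Omega$ for all $t\ge 0$. *)

(* Defs.v *)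
From HB Require Import structures.
From mathcomp Require Import all_boot all_order all_algebra.
From mathcomp Require Import all_classical all_reals all_analysis.

Set Implicit Arguments.
Unset Strict Implicit.
Unset Printing Implicit Defensive.

Import Order.TTheory GRing.Theory Num.Theory.
Import numFieldNormedType.Exports.

Local Open Scope classical_set_scope.
Local Open Scope ring_scope.

Section TridiagonalSystems.
Context {R : realType} {n : nat}.
Implicit Types (f : 'rV[R]_n -> 'rV[R]_n) (x y : R -> 'rV[R]_n).

Definition Mplus : set 'M[R]_n := [set A |
  [/\ (forall i j : 'I_n, (i.+1 < j)%N || (j.+1 < i)%N -> A i j = 0),
      (forall i j : 'I_n, i = j.+1 :> nat -> 0 < A i j) &
      (forall i j : 'I_n, j = i.+1 :> nat -> 0 < A i j)]].

(* [jacobian] acts on row vectors from the right; its transpose is the usual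
   Jacobian matrix, whose entry (i, j) is the partial derivative of the i-th
   component of f with respect to the j-th variable. *)
Definition jacobian_matrix f (p : 'rV[R]_n) : 'M[R]_n := (jacobian f p)^T.

Definition C1_on (U : set 'rV[R]_n) f :=
  forall p, U p -> differentiable f p /\ {for p, continuous (jacobian_matrix f)}.

(* Curves are total functions on R, but only their values on [0, +oo[ matter;
   in particular the derivative at time 0 is the right derivative. *)
Definition is_solution f x :=
  (forall t : R, 0 < t -> is_derive t (1 : R) x (f (x t))) /\
  h^-1 *: (x h - x 0) @[h --> (0 : R)^'+] --> f (x 0).

Definition is_solution_from f (x0 : 'rV[R]_n) x := is_solution f x /\ x 0 = x0.

Definition invariant_set f (Omega : set 'rV[R]_n) :=
  forall x0 : 'rV[R]_n, Omega x0 ->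
    exists x, [/\ is_solution_from f x0 x,
      (forall y, is_solution_from f x0 y -> forall t, 0 <= t -> y t = x t) &
      (forall t, 0 <= t -> Omega (x t))].

Definition equilibrium f (e : 'rV[R]_n) := f e = 0.

End TridiagonalSystems.

(* Main.v *)
(** The velocity [y = f(x(t))] solves [y' = J(x(t)) y] with [J] tridiagonal and
    off-diagonally positive.  If entries of [y t] at indices [k 0 < k 1 < ...]
    alternate in sign, then so do entries of [y s] for every earlier [s], with
    the same sequence of signs: for small [h] the flow is, up to [o(h)], a
    product of scalings and transvections [u i += c * u j] with [j = i +- 1] and
    [c >= 0], and such a map cannot create alternations.  Each sign change of
    [y_1] between [s] and [t] allows [y_1 s] to be put in front of a pattern
    carried back from [t], so [y_1] changes sign fewer than [n] times; hence
    [x_1] is eventually monotone and converges.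

    At a cluster point [p] of [x], [f_1 p = 0] since [x_1] converges; then
    [y_1] tends to [0], so [(J f)_1 p = 0], which gives [f_2 p = 0], and
    inductively [f p = 0].  Two cluster points are thus equilibria with the same
    first coordinate; the mean value theorem along the segment between them,
    applied to [f_1], [f_2], ... successively, shows that they coincide.
    Compactness concludes. *)

Require Import Defs.
From HB Require Import structures.
From mathcomp Require Import all_boot all_order all_algebra.
From mathcomp Require Import all_classical all_reals all_analysis.
From mathcomp Require Import ring lra zify.
Import Order.TTheory GRing.Theory Num.Theory.
Import numFieldNormedType.Exports.
Local Open Scope classical_set_scope.
Local Open Scope ring_scope.

Set Implicit Arguments.
Unset Strict Implicit.
Unset Printing Implicit Defensive.

(** * Alternating sign patterns *)

(** A positive margin [r] forces genuine sign changes, keeps the condition closed in [u] and leaves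
    room for [o(h)] errors. As [k] is a finite function, only finitely many index choices compete in
    the limiting argument. *)
Definition alternation (R : realType) (n m : nat) (b : bool) (r : R)
    (u : 'I_n -> R) : Prop :=
  exists k : {ffun 'I_m -> 'I_n},
    (forall i j : 'I_m, j = i.+1 :> nat -> (k i < k j)%N) /\
    (forall j : 'I_m, r <= (-1) ^+ (b + j)%N * u (k j)).

Lemma alternation_length (R : realType) (n m : nat) (b : bool) (r : R)
    (u : 'I_n -> R) : alternation m b r u -> (m <= n)%N.
Proof.
move=> [k [kmono _]].
have le_k (j : nat) (jm : (j < m)%N) : (j <= k (Ordinal jm))%N.
  elim: j jm => // j IH jm; have jm' : (j < m)%N by exact: ltnW.
  exact: leq_ltn_trans (IH jm') (kmono (Ordinal jm') (Ordinal jm) erefl).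
case: m k kmono le_k => // m k _ le_k.
exact: leq_ltn_trans (le_k m (ltnSn m)) (ltn_ord _).
Qed.

Lemma alternation_weaken (R : realType) (n m : nat) (b : bool) (r r' : R)
    (u u' : 'I_n -> R) : (forall i, `|u i - u' i| <= r - r') ->
  alternation m b r u -> alternation m b r' u'.
Proof.
move=> du [k [kmono kr]]; exists k; split=> // j.
have := kr j; have := du (k j); rewrite ler_norml => /andP[].
rewrite -signr_odd; case: (odd _); rewrite ?expr1 ?expr0; lra.
Qed.

Lemma alternation_nil (R : realType) (n : nat) (b : bool) (r : R)
    (u : 'I_n -> R) : alternation 0 b r u.
Proof.
by exists (ffun0 (card_ord 0)); split=> -[].
Qed.

(** A pattern whose leading sign is opposite to that of [u ord0] cannot use index [0]: only its
    first entry could, with the wrong sign. So [ord0] fits in front. *)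
Lemma alternation_cons (R : realType) (n m : nat) (b : bool) (r : R)
    (u : 'I_n.+1 -> R) : 0 < r -> 0 < (-1) ^+ b * u ord0 ->
  alternation m (~~ b) r u -> exists2 r', 0 < r' & alternation m.+1 b r' u.
Proof.
move=> r0 u0 [k [kmono kr]].
have k_gt0 (j : 'I_m) : (0 < k j)%N.
  have [j' j'j] : exists j' : 'I_m, (j' = 0 :> nat).
    by exists (Ordinal (leq_ltn_trans (leq0n j) (ltn_ord j))).
  have k0 : (0 < k j')%N.
    rewrite lt0n; apply/eqP => kj0; have kE : k j' = ord0 by exact: val_inj.
    have := kr j'; rewrite kE j'j addn0.
    by move: u0; case: b {kr} => /=; rewrite ?expr1 ?expr0; lra.
  case: (posnP j) => [j0|jpos].
    by have -> : j = j' by apply: val_inj; rewrite /= j0 j'j.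
  have j1 : (j.-1 < m)%N by rewrite (leq_ltn_trans (leq_pred j)).
  apply: leq_ltn_trans (kmono (Ordinal j1) j _) => //=.
  by rewrite prednK.
exists (Num.min r ((-1) ^+ b * u ord0)); first by rewrite lt_min r0.
exists [ffun j => if unlift ord0 j is Some j' then k j' else ord0]; split.
  move=> i j; case: (unliftP ord0 j) => [j' ->|-> //].
  case: (unliftP ord0 i) => [i' ->|->]; rewrite !ffunE liftK ?liftK ?unlift_none.
    by move=> [] /kmono.
  by move=> _; exact: k_gt0.
move=> j; rewrite ffunE; case: unliftP => [j' ->|->]; rewrite ge_min.
  apply/orP; left; apply: le_trans (kr j') _; rewrite lift0.
  by case: b {u0 kr} => /=; rewrite ?add0n ?add1n ?exprS ?mulN1r ?opprK ?mulrN// mulN1r opprK.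
by rewrite addn0 lexx orbT.
Qed.

(** * Transvections and their effect on patterns *)

(** For [i = j] this is the scaling of entry [i] by [1 + c]. *)
Definition transvection (R : realType) (n : nat) (i j : 'I_n) (c : R)
    (u : 'I_n -> R) : 'I_n -> R := fun l => u l + (l == i)%:R * (c * u j).

(** Only entry [i] changes. If the pattern uses [i] and [u i] alone does not suffice, the neighbour
    [u j] must have supplied the required sign, and [j] can replace [i] in the pattern. *)
Lemma transvection_alternation (R : realType) (n m : nat) (i j : 'I_n)
    (b : bool) (r c d : R) (u : 'I_n -> R) :
  0 < r -> `|c| <= d -> d < 1 ->
  [\/ c = 0, i = j | 0 <= c /\ (i = j.+1 :> nat \/ j = i.+1 :> nat)] ->
  alternation m b r (transvection i j c u) -> alternation m b (r / (1 + d)) u.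
Proof.
move=> r0 cd d1 adj [k [kmono kr]].
have d0 : 0 <= d by exact: le_trans (normr_ge0 _) cd.
have rd : r / (1 + d) <= r by rewrite ler_pdivrMr; nra.
have rd0 : 0 < r / (1 + d) by apply: divr_gt0 => //; lra.
have rdE : (r / (1 + d)) * (1 + d) = r by rewrite divfK //; lra.
move: cd; rewrite ler_norml => /andP[cd1 cd2].
move: (r / (1 + d)) rd rd0 rdE => r' rd rd0 rdE.
have kne l : k l != i -> r' <= (-1) ^+ (b + l)%N * u (k l).
  move=> kli; have := kr l; rewrite /transvection (negPf kli) mul0r addr0.
  exact: le_trans.
have [[l kl]|ki] := pselect (exists l, k l = i); last first.
  exists k; split=> // l; apply: kne; apply/eqP => kli.
  by apply: ki; exists l.
have kinj l' : k l' = i -> l' = l.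
  have lt_k (p q : nat) (pm : (p < m)%N) (qm : (q < m)%N) :
      (p < q)%N -> (k (Ordinal pm) < k (Ordinal qm))%N.
    elim: q qm => // q IH qm; have qm' : (q < m)%N by exact: ltnW.
    have := kmono (Ordinal qm') (Ordinal qm) erefl.
    move=> kq; rewrite ltnS leq_eqVlt => /orP[/eqP pq|pq]; last first.
      exact: ltn_trans (IH qm' pq) kq.
    by have -> : Ordinal pm = Ordinal qm' by exact: val_inj.
  case: l kl => l lm kl; case: l' => l' lm' kl'; apply: val_inj => /=.
  by have [/(lt_k _ _ lm' lm)|/(lt_k _ _ lm lm')|//] := ltngtP l' l;
    rewrite kl kl' ltnn.
have := kr l; rewrite /transvection kl eqxx mul1r => krl.
have [ui|ui] := leP r' ((-1) ^+ (b + l)%N * u i).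
  exists k; split=> // l'; have [->|lne] := eqVneq l' l; first by rewrite kl.
  by apply: kne; apply: contra_neq lne; exact: kinj.
have [c0 adj'] : 0 <= c /\ (i = j.+1 :> nat \/ j = i.+1 :> nat).
  case: adj => [c0|ij|//]; exfalso; first by move: krl; rewrite c0 mul0r addr0; lra.
  move: krl; rewrite -ij.
  have -> : (-1) ^+ (b + l)%N * (u i + c * u i) =
            (-1) ^+ (b + l)%N * u i * (1 + c) by ring.
  set v := _ * u i in ui *; nra.
(* From [v < r'], [v + c * w >= r = r' * (1 + d)] and [0 <= c <= d] follows
   [c * w > d * r' >= c * r'], hence [w > r']. *)
have uj : r' <= (-1) ^+ (b + l)%N * u j.
  move: krl ui.
  have -> : (-1) ^+ (b + l)%N * (u i + c * u j) =
            (-1) ^+ (b + l)%N * u i + c * ((-1) ^+ (b + l)%N * u j) by ring.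
  move: (_ * u i) (_ * u j) => v w; nra.
(* Positions next to [l] ask for the opposite sign, so they cannot sit at [j]; hence replacing [i]
   by the adjacent [j] keeps the sequence strictly increasing. *)
have knej (l' : 'I_m) : l' = l.+1 :> nat \/ l = l'.+1 :> nat -> k l' <> j.
  move=> ll' kj; have kli : k l' != i.
    by apply/eqP => /kinj e; case: ll'; rewrite e => /n_Sn.
  have := kne _ kli; rewrite kj.
  have -> : (-1) ^+ (b + l')%N * u j = - ((-1) ^+ (b + l)%N * u j).
    by case: ll' => ->; rewrite addnS exprS; ring.
  lra.
exists [ffun l' => if l' == l then j else k l']; split; last first.
  move=> l'; rewrite ffunE; have [->//|lne] := eqVneq l' l.
  by apply: kne; apply: contra_neq lne; exact: kinj.
move=> p q pq; rewrite !ffunE; have kpq := kmono p q pq.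
have [pl|pl] := eqVneq p l; have [ql|ql] := eqVneq q l.
- by move: pq; rewrite pl ql => /n_Sn.
- have kqj : (j != k q :> nat).
    by apply/eqP => /val_inj/esym; apply: knej; left; rewrite pq pl.
  move: kpq; rewrite pl kl => kpq; case: adj' => ij.
    by apply: ltn_trans kpq; rewrite ij.
  by rewrite ltn_neqAle kqj ij.
- have kpj : (k p != j :> nat).
    by apply/eqP => /val_inj; apply: knej; right; rewrite -pq ql.
  move: kpq; rewrite ql kl => kpq; case: adj' => ij.
    by rewrite ltn_neqAle kpj -ltnS -ij.
  by apply: ltn_trans kpq _; rewrite ij.
- exact: kpq.
Qed.

(** When [s] lists every pair once, this is [u + h A u] to first order in [h]. *)
Definition transvections (R : realType) (n : nat) (A : 'M[R]_n) (h : R)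
    (s : seq ('I_n * 'I_n)) (u : 'I_n -> R) : 'I_n -> R :=
  foldr (fun p v => transvection p.1 p.2 (h * A p.1 p.2) v) u s.

Lemma transvections_alternation (R : realType) (n m : nat) (A : 'M[R]_n)
    (b : bool) (r h K : R) (s : seq ('I_n * 'I_n)) (u : 'I_n -> R) :
  0 < r -> 0 <= h -> h * K < 1 -> (forall i j, `|A i j| <= K) -> Mplus A ->
  alternation m b r (transvections A h s u) ->
  alternation m b (r / (1 + h * K) ^+ size s) u.
Proof.
move=> r0 h0 hK AK [A0 Asub Asup]; elim: s r r0 => [|[i j] s IH] r r0 /=.
  by rewrite expr0 divr1.
move=> alt; have K0 : 0 <= K by apply: le_trans (normr_ge0 _) (AK i j).
have hK0 : 0 < 1 + h * K by nra.
rewrite exprS invfM mulrA; apply: IH; first exact: divr_gt0.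
apply: transvection_alternation alt => //.
  by rewrite normrM ger0_norm // ler_wpM2l.
have [ij|ij|/val_inj ->] := ssrnat.ltngtP i j; last by constructor 2.
- have [ji|ji] := eqVneq (nat_of_ord j) i.+1.
    by constructor 3; split; [rewrite mulr_ge0 // ltW // Asup|right].
  constructor 1; rewrite A0 ?mulr0 //; apply/orP; left; lia.
- have [ji|ji] := eqVneq (nat_of_ord i) j.+1.
    by constructor 3; split; [rewrite mulr_ge0 // ltW // Asub|left].
  constructor 1; rewrite A0 ?mulr0 //; apply/orP; right; lia.
Qed.

(** At [h = 0] every factor is the identity, so the first-order contributions add up, whatever the
    order of [s]. *)
Lemma transvections_derive (R : realType) (n : nat) (A : 'M[R]_n)
    (s : seq ('I_n * 'I_n)) (u : R -> 'I_n -> R) (du : 'I_n -> R) :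
  (forall l, is_derive 0 (1 : R) (fun h => u h l) (du l)) ->
  forall l, is_derive 0 (1 : R) (fun h => transvections A h s (u h) l)
    (du l + \sum_(p <- s) (l == p.1)%:R * (A p.1 p.2 * u 0 p.2)).
Proof.
move=> dudt; elim: s => [|[i j] s IH] l /=; first by rewrite big_nil addr0.
have tr0 t i0 : transvections A 0 t (u 0) i0 = u 0 i0.
  elim: t => [//|q t IHt] /=.
  by rewrite /transvection mul0r mul0r mulr0 addr0 IHt.
rewrite big_cons /=.
have dl := IH l; have dj := IH j.
rewrite /transvection.
apply: is_derive_eq.
by rewrite /= tr0 /GRing.scale /=; ring.
Qed.

(** * Derivative and exponential estimates *)

Lemma is_derive_chain (R : realType) (V W : normedModType R) (x : R -> V)
    (f : V -> W) (t : R) (v : V) :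
  is_derive t (1 : R) x v -> differentiable f (x t) ->
  is_derive t (1 : R) (f \o x) ('d f (x t) v).
Proof.
move=> [dx <-] df; have dx' : differentiable x t by exact/derivable1_diffP.
have dfx : differentiable (f \o x) t by exact: differentiable_comp.
split; first exact: diff_derivable.
by rewrite !deriveE // diff_comp.
Qed.

Lemma is_derive0_littleo (R : realType) (g : R -> R) (e : R) :
  is_derive (0 : R) 1 g 0 -> 0 < e ->
  \forall h \near (0 : R)^'+, `|g 0 - g h| <= e * h.
Proof.
move=> [dg1 dg0] e0.
have : h^-1 *: (g (h *: 1 + 0) - g 0) @[h --> 0^'] --> (0 : R).
  by rewrite -[in X in _ --> X]dg0; exact: dg1.
move/cvgrPdist_le => /(_ e e0) /= [d d0 gd].
exists d => // h hd h0; have := gd h hd (lt0r_neq0 h0).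
rewrite sub0r normrN normrM normfV (gtr0_norm h0) addr0 /GRing.scale /= mulr1.
by rewrite ler_pdivrMl // distrC mulrC.
Qed.

(** A backward step costs a factor [1 - h / 2] for the [o(h)] error and a division by [1 + h * K]
    for each of [N] transvections; an exponential bound lets these losses compose over many
    steps. *)
Lemma expR_decay (R : realType) (N : nat) (K h : R) : 0 <= K -> 0 <= h <= 1 ->
  expR (- (K * N%:R + 1) * h) <= (1 - h / 2) / (1 + h * K) ^+ N.
Proof.
move=> K0 /andP[h0 h1]; have hK : 0 < 1 + h * K by nra.
rewrite ler_pdivlMr ?exprn_gt0 //.
have le1 : (1 + h * K) ^+ N <= expR (h * K * N%:R).
  by rewrite expRM_natr lerXn2r ?nnegrE ?expR_ge0 ?expR_ge1Dx // ltW.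
apply: le_trans (ler_wpM2l (expR_ge0 _) le1) _; rewrite -expRD.
have -> : - (K * N%:R + 1) * h + h * K * N%:R = - h by ring.
rewrite expRN -div1r ler_pdivrMr ?expR_gt0 //.
have := expR_ge1Dx h; nra.
Qed.

(** * Carrying patterns backward in time *)

(** The transvections applied to [y (t - h)] have zero derivative at [h = 0], as [- A y] and [A y]
    cancel. They thus reproduce [y t] up to [r / 2 * h], and the pattern at [t] passes back through
    them. *)
Lemma alternation_step (R : realType) (n m : nat) (b : bool) (r K t : R)
    (A : 'M[R]_n) (y : R -> 'I_n -> R) :
  0 < r -> 0 <= K -> (forall i j, `|A i j| <= K) -> Mplus A ->
  (forall i, is_derive t (1 : R) (y^~ i) (\sum_j A i j * y t j)) ->
  alternation m b r (y t) ->
  \forall h \near (0 : R)^'+,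
    alternation m b (r * expR (- (K * #|{: 'I_n * 'I_n}|%:R + 1) * h)) (y (t - h)).
Proof.
move=> r0 K0 AK AM dy alt.
pose s := enum {: 'I_n * 'I_n}.
have du l : is_derive 0 (1 : R) (fun h => y (t - h) l) (- \sum_j A l j * y t j).
  have dh : is_derive 0 (1 : R) (fun h : R => t - h) (- 1).
    by apply: is_derive_eq; rewrite add0r mul1r.
  have dyl : differentiable (y^~ l) (t - 0).
    by rewrite subr0; apply/derivable1_diffP; case: (dy l).
  apply: is_derive_eq (is_derive_chain dh dyl) _.
  rewrite subr0 linearN -deriveE; last by rewrite -[t]subr0.
  by case: (dy l) => _ ->.
have dB l : is_derive 0 (1 : R)
    (fun h => transvections A h s (fun i => y (t - h) i) l) 0.
  apply: is_derive_eq (transvections_derive A s du l) _.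
  rewrite /s big_enum /=.
  rewrite -(pair_bigA _ (fun i j => (l == i)%:R * (A i j * y (t - 0) j))) /=.
  have -> : \sum_i \sum_j (l == i)%:R * (A i j * y (t - 0) j) =
            \sum_j A l j * y t j.
    rewrite (bigD1 l) //= [X in _ + X]big1 => [|i il]; last first.
      by apply: big1 => j _; rewrite eq_sym (negPf il) mul0r.
    by rewrite addr0 eqxx subr0; under eq_bigr do rewrite mul1r.
  by rewrite addNr.
have near_B : \forall h \near (0 : R)^'+, forall l,
    `|y t l - transvections A h s (fun i => y (t - h) i) l| <= r / 2 * h.
  apply: filter_forall => l.
  have tr0 s' i : transvections A 0 s' (fun i => y (t - 0) i) i = y t i.
    elim: s' => [|q s' IH] /=; first by rewrite subr0.
    by rewrite /transvection mul0r mul0r mulr0 addr0 IH.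
  by have := is_derive0_littleo (dB l) (divr_gt0 r0 (ltr0Sn _ 1)); rewrite tr0.
have K1 : 0 < (K + 1)^-1 by rewrite invr_gt0; lra.
near=> h.
have h0 : 0 < h by [].
have h1 : h <= 1 by near: h; exact: nbhs_right_le.
have hK : h * K < 1.
  have : h <= (K + 1)^-1 by near: h; exact: (nbhs_right_le K1).
  rewrite -(ler_pM2r (_ : 0 < K + 1)); last by lra.
  by rewrite mulVf; [nra|lra].
have hB : forall l,
    `|y t l - transvections A h s (fun i => y (t - h) i) l| <= r / 2 * h.
  by near: h; exact: near_B.
have altB : alternation m b (r * (1 - h / 2))
    (transvections A h s (fun i => y (t - h) i)).
  apply: alternation_weaken alt => l.
  have -> : r - r * (1 - h / 2) = r / 2 * h by ring.
  exact: hB.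
have r10 : 0 < r * (1 - h / 2) by apply: mulr_gt0 => //; lra.
have := transvections_alternation r10 (ltW h0) hK AK AM altB.
apply: alternation_weaken => i; rewrite subrr normr0 subr_ge0.
rewrite -mulrA ler_pM2l // /s -cardE; apply: expR_decay => //.
by rewrite (ltW h0).
Unshelve. all: by end_near. Qed.

(** Continuous induction: the infimum of the times in [[s, T]] carrying the pattern carries it too,
    by closedness, and the one-step lemma goes below it unless it is [s]. *)
Lemma alternation_backward (R : realType) (n m : nat) (b : bool) (r K s T : R)
    (A : R -> 'M[R]_n) (y : R -> 'I_n -> R) :
  (forall t, 0 < t -> Mplus (A t)) -> 0 <= K ->
  (forall t i j, 0 < t -> `|A t i j| <= K) ->
  (forall (t : R) i, 0 < t -> is_derive t (1 : R) (y^~ i) (\sum_j A t i j * y t j)) ->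
  0 < r -> 0 < s -> s <= T -> alternation m b r (y T) ->
  exists2 r', 0 < r' & alternation m b r' (y s).
Proof.
move=> AM K0 AK dy r0 s0 sT altT.
pose c := K * #|{: 'I_n * 'I_n}|%:R + 1.
(* The margin follows the rate of [alternation_step]: [rho (t - h) = rho t * expR (- c * h)]. *)
pose rho (t : R) := r * expR (c * (t - T)).
have rho0 t : 0 < rho t by rewrite mulr_gt0 ?expR_gt0.
pose E := [set t | s <= t <= T /\ alternation m b (rho t) (y t)].
have ET : E T.
  by split; rewrite ?sT ?lexx // /rho subrr mulr0 expR0 mulr1.
have Elb : lbound E s by move=> t [/andP[]].
have Einf : has_inf E by split; [exists T|exists s].
have sE : s <= inf E by apply: lb_le_inf => //; exists T.
have ET' : inf E <= T by apply: ge_inf => //; exists s.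
have E0 : 0 < inf E := lt_le_trans s0 sE.
have infE : alternation m b (rho (inf E)) (y (inf E)).
  apply: contrapT => nalt.
  (* [P k t] says that the choice [k] fails strictly at [t], an open condition. With finitely many
     [k], failure of all of them at [inf E] persists nearby, against elements of [E] close to
     [inf E]. *)
  pose P (k : {ffun 'I_m -> 'I_n}) (t : R) :=
    (forall i j : 'I_m, j = i.+1 :> nat -> (k i < k j)%N) ->
    exists j : 'I_m, (-1) ^+ (b + j)%N * y t (k j) < rho t.
  have near_k : \forall t \near inf E, forall k, P k t.
    apply: (@filter_forall _ _ P (nbhs (inf E)) (nbhs_filter _)) => k.
    have [kmono|nk] := pselect (forall i j : 'I_m, j = i.+1 :> nat -> (k i < k j)%N);
      last by apply: nearW => t /nk.
    have [j yj] : exists j : 'I_m,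
        (-1) ^+ (b + j)%N * y (inf E) (k j) < rho (inf E).
      apply: contrapT => nj; apply: nalt; exists k; split=> // j.
      by rewrite leNgt; apply/negP => lt_j; apply: nj; exists j.
    have cy : {for inf E, continuous (fun t => rho t - (-1) ^+ (b + j)%N * y t (k j))}.
      apply: cvgB.
        apply: cvgM; first exact: cvg_cst.
        apply: continuous_comp; last exact: continuous_expR.
        apply: cvgM; first exact: cvg_cst.
        by apply: cvgB; [exact: cvg_id|exact: cvg_cst].
      apply: cvgM; first exact: cvg_cst.
      apply: differentiable_continuous; apply/derivable1_diffP.
      by case: (dy _ (k j) E0).
    have : \forall t \near inf E, 0 < rho t - (-1) ^+ (b + j)%N * y t (k j).
      have := cy; rewrite /continuous_at /= => cy'.
      by apply: (@cvgr_gt _ _ _ (nbhs_filter _) _ _ cy'); rewrite subr_gt0.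
    by apply: filterS => t; rewrite subr_gt0 => yt _; exists j.
  have [d d0 dE] := near_k.
  have [t Et tE] := inf_adherent d0 Einf.
  have : E t by []; move=> [_ [k [kmono kr]]].
  have tE' : inf E <= t by apply: ge_inf => //; exists s.
  have [|j] := dE t _ k kmono.
    by rewrite /ball /= distrC ger0_norm ?subr_ge0 // ltrBlDl.
  by rewrite ltNge kr.
have [->|sE'] := eqVneq s (inf E); first by exists (rho (inf E)).
have lt_s : s < inf E by rewrite lt_neqAle sE'.
have step := alternation_step (rho0 _) K0 (fun i j => AK _ i j E0)
  (AM _ E0) (fun i => dy _ i E0) infE.
near ((0 : R)^'+) => h.
have h0 : 0 < h by [].
have hE : inf E - h < inf E by rewrite ltrBlDr ltrDl.
suff /(ge_inf (ex_intro _ s Elb)) : E (inf E - h) by rewrite leNgt hE.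
split.
  have -> : s <= inf E - h.
    rewrite lerBrDr -lerBrDl; near: h; apply: nbhs_right_le; by rewrite subr_gt0.
  by rewrite /= (le_trans (ltW hE)).
have -> : rho (inf E - h) = rho (inf E) * expR (- c * h).
  by rewrite /rho -mulrA -expRD; congr (_ * expR _); ring.
by near: h.
Unshelve. all: by end_near. Qed.

Lemma head_eventually_signed (R : realType) (n : nat) (K : R)
    (A : R -> 'M[R]_n) (y : R -> 'I_n -> R) (i0 : 'I_n) : i0 = 0 :> nat ->
  (forall t, 0 < t -> Mplus (A t)) -> 0 <= K ->
  (forall t i j, 0 < t -> `|A t i j| <= K) ->
  (forall (t : R) i, 0 < t -> is_derive t (1 : R) (y^~ i) (\sum_j A t i j * y t j)) ->
  exists b : bool, exists2 T, 0 < T & forall t, T < t -> 0 <= (-1) ^+ b * y t i0.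
Proof.
case: n A y i0 => [|n] A y i0; first by case: i0.
move=> i00; have {i0 i00} -> : i0 = ord0 by exact: val_inj.
move=> AM K0 AK dy; apply: contrapT => noT.
have alternates (b : bool) (T : R) : 0 < T ->
    exists2 t, T < t & 0 < (-1) ^+ b * y t ord0.
  move=> T0; apply: contrapT => not; apply: noT; exists (~~ b), T => // t Tt.
  rewrite leNgt; apply/negP => yt; apply: not; exists t => //.
  by move: yt; case: (b); rewrite /= ?expr1 ?expr0; lra.
(* [T] is universal so that the shorter pattern can be sought after the time [s] at which the first
   entry has the new leading sign. *)
have long m : forall (b : bool) (T : R), 0 < T ->
    exists t, [/\ T < t & exists2 r, 0 < r & alternation m b r (y t)].
  elim: m => [|m IH] b T T0.
    exists (T + 1); split; first by rewrite ltrDl.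
    by exists 1 => //; exact: alternation_nil.
  have [s Ts ys] := alternates b T T0.
  have s0 : 0 < s by exact: lt_trans Ts.
  have [t [st [r r0 alt]]] := IH (~~ b) s s0.
  exists s; split=> //.
  have [r' r'0 alt'] := alternation_backward AM K0 AK dy r0 s0 (ltW st) alt.
  exact: alternation_cons r'0 ys alt'.
(* After the case split there are [n.+1] coordinates, one fewer than this length. *)
have [t [_ [r _ /alternation_length]]] := long n.+2 false 1 ltr01.
by rewrite ltnn.
Qed.

(** * Limits at infinity and cluster points *)

Lemma MVT_ray (R : realType) (g dg : R -> R) (a b : R) :
  (forall t : R, 0 < t -> is_derive t (1 : R) g (dg t)) -> 0 < a -> a < b ->
  exists2 c, a < c < b & g b - g a = dg c * (b - a).
Proof.
move=> dgdt a0 ab.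
have [t||c] := @MVT R g dg a b ab.
- by rewrite in_itv /= => /andP[/(lt_trans a0) + _]; exact: dgdt.
- apply: derivable_within_continuous => t; rewrite in_itv /= => /andP[/(lt_le_trans a0) t0 _].
  by case: (dgdt _ t0).
- by rewrite in_itv /= => cab cE; exists c.
Qed.

Lemma nondecreasing_bounded_cvg (R : realType) (g dg : R -> R) (T M : R) :
  (forall t : R, 0 < t -> is_derive t (1 : R) g (dg t)) ->
  (forall t, T < t -> 0 <= dg t) -> (forall t, 0 < t -> g t <= M) -> 0 < T ->
  exists c : R, g t @[t --> +oo] --> c.
Proof.
move=> dgdt dg0 gM T0.
(* Freezing [g] before [T] gives a function monotone on the whole line with the same behaviour at
   infinity. *)
pose G t := g (Num.max t T).
have Gmono : nondecreasing_fun G.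
  move=> s t st; rewrite /G.
  have [mt|] := ltP (Num.max s T) (Num.max t T); last first.
    move=> ts; have -> : Num.max s T = Num.max t T; last by [].
    by apply/le_anti; rewrite ts andbT ge_max !le_max st lexx orbT.
  have m0 : 0 < Num.max s T by rewrite lt_max T0 orbT.
  have [c /andP[mc _] gE] := MVT_ray dgdt m0 mt.
  rewrite -subr_ge0 gE mulr_ge0 ?subr_ge0 ?(ltW mt) // dg0 //.
  by apply: le_lt_trans mc; rewrite le_max lexx orbT.
have Gub : has_ubound (range G).
  by exists M => _ [t _ <-]; apply: gM; rewrite lt_max T0 orbT.
exists (sup (range G)); apply: cvg_trans (nondecreasing_cvgr Gmono Gub).
apply: near_eq_cvg; near=> t; rewrite /G max_l //; near: t.
Unshelve. all: by end_near. Qed.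

(* If phi p > 0, each visit of x near p makes g grow by a fixed amount,
   because x needs a fixed time to leave a neighbourhood of p. *)
Lemma cluster_derivative_le0 (R : realType) (V : normedModType R) (x : R -> V)
    (g : R -> R) (phi : V -> R) (c L : R) (p : V) :
  (forall s t, 0 < s -> s <= t -> `|x t - x s| <= L * (t - s)) ->
  (forall t : R, 0 < t -> is_derive t (1 : R) g (phi (x t))) ->
  g t @[t --> +oo] --> c -> {for p, continuous phi} ->
  cluster (x t @[t --> +oo]) p -> phi p <= 0.
Proof.
move=> xL dg gc cphi xp; rewrite leNgt; apply/negP => phi0.
have half0 : 0 < phi p / 2 by rewrite divr_gt0.
have : \forall q \near p, phi p / 2 < phi q.
  by apply: (@cvgr_gt _ _ _ (nbhs_filter _) _ _ cphi); lra.
move/nbhs_ballP => [d /= d0 dphi].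
have d20 : 0 < d / 2 by rewrite divr_gt0.
(* A positive speed bound: within time [tau] the curve moves less than [d / 2], so it stays where
   [phi > phi p / 2]. *)
pose M := `|L| + 1; have M0 : 0 < M by rewrite ltr_wpDl.
pose tau := d / 2 / M; have tau0 : 0 < tau by rewrite divr_gt0.
(* Half of the growth forced during [tau]; two values of [g] this close to [c] cannot differ by that
   growth. *)
have e0 : 0 < phi p / 2 * tau / 2 by apply: divr_gt0 => //; apply: mulr_gt0.
have [T [_ gT]] : \forall t \near +oo, `|c - g t| < phi p / 2 * tau / 2.
  by move/cvgrPdist_lt : gc; apply.
have far : (x t @[t --> +oo]) [set q | exists2 t, Num.max T 1 < t & q = x t].
  exists (Num.max T 1); split; first exact: num_real.
  by move=> t Tt /=; exists t.
have [_ [[t Tt ->] pt]] := xp _ _ far (nbhsx_ballx p (d / 2) d20).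
move: Tt; rewrite gt_max => /andP[Tt t1].
have t0 : 0 < t by exact: lt_trans t1.
have ttau : t < t + tau by rewrite ltrDl.
have [s /andP[ts st] gE] := MVT_ray dg t0 ttau.
have xs : ball p d (x s).
  rewrite (splitr d); apply: ball_triangle pt _.
  rewrite -ball_normE /= distrC (le_lt_trans (xL _ _ t0 (ltW ts))) //.
  have L1 : L < M by rewrite /M ltr_pwDr // ler_norm.
  have dM : d / 2 = tau * M by rewrite /tau divfK // gt_eqF.
  rewrite dM; nra.
have phis := dphi _ xs.
have g1 := gT _ Tt; have g2 := gT _ (lt_trans Tt ttau).
move: g1 g2; rewrite !ltr_norml => /andP[g1 g1'] /andP[g2 g2'].
have gE' : g (t + tau) - g t = phi (x s) * tau by rewrite gE; ring.
nra.
Qed.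

Lemma cluster_derivative_eq0 (R : realType) (V : normedModType R) (x : R -> V)
    (g : R -> R) (phi : V -> R) (c L : R) (p : V) :
  (forall s t, 0 < s -> s <= t -> `|x t - x s| <= L * (t - s)) ->
  (forall t : R, 0 < t -> is_derive t (1 : R) g (phi (x t))) ->
  g t @[t --> +oo] --> c -> {for p, continuous phi} ->
  cluster (x t @[t --> +oo]) p -> phi p = 0.
Proof.
move=> xL dg gc cphi xp; apply/le_anti.
rewrite (cluster_derivative_le0 xL dg gc cphi xp) /= -oppr_le0.
apply: (@cluster_derivative_le0 _ _ x (- g) (- phi) (- c) L) => //.
- by move=> t t0; have dgt := dg t t0; exact: is_deriveN.
- exact: cvgN.
- exact: cvgN.
Qed.

(** If [psi (x t)] were not eventually in a neighbourhood [B] of [c], the filter restricted to the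
    bad times would be proper; by compactness it has a cluster point, also one for [F], where
    continuity of [psi] gives a contradiction. *)
Lemma cluster_cvg (T : Type) (X Y : topologicalType) (F : set_system T)
    (FF : Filter F) (x : T -> X) (K : set X) (psi : X -> Y) (c : Y) :
  compact K -> (\forall t \near F, K (x t)) ->
  (forall p, K p -> cluster (x t @[t --> F]) p ->
    psi p = c /\ {for p, continuous psi}) ->
  psi (x t) @[t --> F] --> c.
Proof.
move=> cK FK psic B cB; apply: contrapT => nB.
pose G := within [set t | ~ B (psi (x t))] F.
have GF : ProperFilter G.
  split; last exact: within_filter.
  move=> G0; apply: nB.
  have G0' : F [set t | ~ B (psi (x t)) -> False] by exact: G0.
  by apply: (@filterS _ F FF _ _ _ G0') => t /= /contrapT.
have [p [Kp xp]] : K `&` cluster (x @ G) !=set0.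
  by apply: cK; exact: filterS FK.
have xFp : cluster (x @ F) p.
  by move=> C D FC; apply: xp; exact: (@filterS _ F FF _ _ (fun t Ct _ => Ct) FC).
have [pc cpsi] := psic p Kp xFp.
have GB : (x @ G) [set q | ~ B (psi q)] by apply: (@filterE _ F FF).
have pB : nbhs p (psi @^-1` B) by apply: cpsi; rewrite pc.
by have [q [/= nBq /nBq]] := xp _ _ GB pB.
Qed.

(** * Curves and vector fields in coordinates *)

Lemma is_derive_coord (R : realType) (n : nat) (x : R -> 'rV[R]_n) (t : R)
    (v : 'rV[R]_n) (i : 'I_n) :
  is_derive t (1 : R) x v -> is_derive t (1 : R) (fun s => x s 0 i) (v 0 i).
Proof.
move=> [dx <-]; split; first by move/derivable_mxP : dx; apply.
by rewrite derive_mx // mxE.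
Qed.

(** The arbitrary velocity [v] serves both the trajectory, with [v = f (x t)], and a segment, with
    [v = p - q]. *)
Lemma is_derive_vector_field (R : realType) (n : nat)
    (f : 'rV[R]_n -> 'rV[R]_n) (x : R -> 'rV[R]_n) (t : R) (v : 'rV[R]_n)
    (i : 'I_n) :
  is_derive t (1 : R) x v -> differentiable f (x t) ->
  is_derive t (1 : R) (fun s => f (x s) 0 i)
    (\sum_j jacobian_matrix f (x t) i j * v 0 j).
Proof.
move=> dx df; apply: is_derive_eq (is_derive_coord i (is_derive_chain dx df)) _.
rewrite -deriveE // deriveEjacobian // mxE; apply: eq_bigr => j _.
by rewrite mulrC; congr (_ * _); rewrite /jacobian_matrix [RHS]mxE.
Qed.

Lemma ler_norm_coord (R : realType) (n : nat) (v : 'rV[R]_n) (i : 'I_n) :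
  `|v 0 i| <= `|v|.
Proof.
rewrite [leRHS]/Num.Def.normr /= mx_normrE.
exact: (le_bigmax _ (fun ij => `|v ij.1 ij.2|) (0, i)).
Qed.

(** The norm is the maximum norm, so the scalar mean value theorem in each coordinate suffices. *)
Lemma lipschitz_ray (R : realType) (n : nat) (x dx : R -> 'rV[R]_n) (L : R) :
  (forall t : R, 0 < t -> is_derive t (1 : R) x (dx t)) ->
  (forall t, 0 < t -> `|dx t| <= L) ->
  forall s t, 0 < s -> s <= t -> `|x t - x s| <= L * (t - s).
Proof.
move=> dxdt dxL s t s0; rewrite le_eqVlt => /predU1P[->|st].
  by rewrite !subrr normr0 mulr0.
have L0 : 0 <= L by apply: le_trans (dxL s s0).
rewrite [leLHS]/Num.Def.normr /= mx_normrE.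
apply: bigmax_le => [|[i j] _]; first by rewrite mulr_ge0 // subr_ge0 ltW.
rewrite /= (ord1 i) !mxE.
have dj (u : R) : 0 < u -> is_derive u (1 : R) (fun s => x s 0 j) (dx u 0 j).
  by move=> u0; apply: is_derive_coord; exact: dxdt.
have [c /andP[sc _] ->] := MVT_ray dj s0 st.
rewrite normrM (ger0_norm (_ : 0 <= t - s)) ?subr_ge0 ?(ltW st) //.
rewrite ler_wpM2r ?subr_ge0 ?(ltW st) //.
exact: le_trans (ler_norm_coord _ _) (dxL _ (lt_trans s0 sc)).
Qed.

(** * Consequences of the tridiagonal structure *)

(** Row [i] vanishes beyond column [i.+1], so the sum reduces to [A i j * v j] with [A i j]
    positive. *)
Lemma Mplus_next_eq0 (R : realType) (n : nat) (A : 'M[R]_n) (v : 'I_n -> R)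
    (i j : 'I_n) : Mplus A -> j = i.+1 :> nat ->
  \sum_l A i l * v l = 0 -> (forall l : 'I_n, (l <= i)%N -> v l = 0) -> v j = 0.
Proof.
move=> [A0 _ Asup] ji sum0 v0.
have Aij : 0 < A i j by exact: Asup.
move: sum0; rewrite (bigD1 j) //= big1 ?addr0 => [|l lj].
  by move/eqP; rewrite mulf_eq0 (gt_eqF Aij) /= => /eqP.
have [li|il] := leqP l i; first by rewrite v0 // mulr0.
rewrite A0 ?mul0r // -ji ltn_neqAle; apply/orP; left.
by rewrite eq_sym lj ji.
Qed.

Lemma convex_segment (R : realType) (n : nat) (Omega : set 'rV[R]_n)
    (p q : 'rV[R]_n) (s : R) : @convex_set R 'rV[R]_n Omega ->
  Omega p -> Omega q -> 0 <= s <= 1 -> Omega (q + s *: (p - q)).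
Proof.
move=> convO Op Oq /andP[s0 s1].
have := convO p q (Itv01 s0 s1); rewrite !inE => /(_ Op Oq).
suff -> : conv (Itv01 s0 s1) (p : convex_lmodType 'rV[R]_n) q = q + s *: (p - q) by [].
transitivity (s *: p + (1 - s : R) *: q); first by [].
apply/rowP => i; rewrite !mxE; ring.
Qed.

Lemma MVT_vector_field (R : realType) (n : nat) (f : 'rV[R]_n -> 'rV[R]_n)
    (p q : 'rV[R]_n) (i : 'I_n) :
  (forall s, 0 <= s <= 1 -> differentiable f (q + s *: (p - q))) ->
  exists2 s, 0 <= s <= 1 & f p 0 i - f q 0 i =
    \sum_j jacobian_matrix f (q + s *: (p - q)) i j * (p - q) 0 j.
Proof.
move=> df; pose x (s : R) := q + s *: (p - q).
have dx (s : R) : is_derive s (1 : R) x (p - q).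
  have quot : h^-1 *: ((x \o shift s) (h *: 1) - x s) @[h --> 0^'] --> p - q.
    have quotE : \forall h \near (0 : R)^',
        p - q = h^-1 *: ((x \o shift s) (h *: 1) - x s).
      near=> h; have h0 : h != 0 by near: h; exact: nbhs_dnbhs_neq.
      have -> : (x \o shift s) (h *: 1) - x s = h *: (p - q).
        by apply/rowP => j; rewrite /x /= /GRing.scale /= !mxE; ring.
      by rewrite scalerA mulVf // scale1r.
    exact: cvg_trans (near_eq_cvg quotE) (cvg_cst (p - q)).
  by split; [exact: cvgP quot|exact: cvg_lim quot].
have dfx (s : R) : 0 <= s <= 1 -> is_derive s (1 : R) (fun s => f (x s) 0 i)
    (\sum_j jacobian_matrix f (x s) i j * (p - q) 0 j).
  by move=> s01; apply: is_derive_vector_field => //; exact: df.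
have [s||s] := MVT ltr01 (f := fun s => f (x s) 0 i)
    (df := fun s => \sum_j jacobian_matrix f (x s) i j * (p - q) 0 j).
- by rewrite in_itv /= => /andP[s0 s1]; apply: dfx; rewrite !ltW.
- apply: derivable_within_continuous => s; rewrite in_itv /= => s01.
  by case: (dfx _ s01).
- rewrite in_itv /= => /andP[s0 s1]; rewrite /x scale1r scale0r addr0 subr0 mulr1.
  by rewrite addrCA subrr addr0 => sE; exists s; rewrite ?ltW.
Unshelve. all: by end_near. Qed.

(** The intermediate point on the segment depends on the component [k], which is harmless: each
    induction step uses only row [k] of the Jacobian there. *)
Lemma Mplus_field_inj (R : realType) (n : nat) (f : 'rV[R]_n -> 'rV[R]_n)
    (Omega : set 'rV[R]_n) (p q : 'rV[R]_n) :
  @convex_set R 'rV[R]_n Omega -> (forall p, Omega p -> differentiable f p) ->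
  (forall p, Omega p -> Mplus (jacobian_matrix f p)) ->
  Omega p -> Omega q -> f p = f q ->
  (forall i : 'I_n, i = 0 :> nat -> p 0 i = q 0 i) -> p = q.
Proof.
move=> convO df fM Op Oq fpq pq0.
suff pq k : forall i : 'I_n, (i <= k)%N -> (p - q) 0 i = 0.
  by apply/rowP => i; have := pq n i (ltnW (ltn_ord i)); rewrite !mxE => /subr0_eq.
elim: k => [|k IH] i.
  by rewrite leqn0 => /eqP i0; rewrite !mxE pq0 // subrr.
rewrite leq_eqVlt => /predU1P[ik|]; last exact: IH.
have kn : (k < n)%N by apply: ltn_trans (ltn_ord i); rewrite ik.
have Oseg s : 0 <= s <= 1 -> Omega (q + s *: (p - q)).
  by move=> s01; exact: convex_segment.
have [|s s01 sE] := @MVT_vector_field R n f p q (Ordinal kn).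
  by move=> s s01; apply: df; exact: Oseg.
apply: (Mplus_next_eq0 (v := fun j => (p - q) 0 j) (fM _ (Oseg s s01)) (i := Ordinal kn)) => //.
by rewrite -sE fpq subrr.
Qed.

(** * Convergence of trajectories *)

Theorem corollary1 (R : realType) (n : nat)
    (f : 'rV[R]_n -> 'rV[R]_n) (U Omega : set 'rV[R]_n)
    (openU : open U) (OmegaU : Omega `<=` U)
    (Omega_inv : invariant_set f Omega)
    (Omega_compact : compact Omega)
    (Omega_convex : @convex_set R 'rV[R]_n Omega)
    (f_C1 : C1_on U f)
    (f_jac : forall p, Omega p -> Mplus (jacobian_matrix f p)) :
  forall (x0 : 'rV[R]_n) (x : R -> 'rV[R]_n),
    Omega x0 -> is_solution_from f x0 x ->
    exists e : 'rV[R]_n,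
      [/\ Omega e, equilibrium f e & x t @[t --> +oo] --> e].
Proof.
move=> x0 x Ox0 solx.
(* Uniqueness identifies [x] with the solution that invariance keeps in [Omega]. *)
have Ox t : 0 <= t -> Omega (x t).
  move=> t0; have [z [_ uniq Oz]] := Omega_inv _ Ox0.
  by rewrite (uniq _ solx _ t0); exact: Oz.
have [[dx _] _] := solx.
have df p : Omega p -> differentiable f p by move=> /OmegaU /f_C1[].
have cf p i : Omega p -> {for p, continuous (fun q => f q 0 i)}.
  move=> /df /differentiable_continuous cfp.
  exact: (continuous_comp (g := fun v : 'rV[R]_n => v 0 i) cfp (@coord_continuous _ _ _ _ _ _)).
have cJ p i j : Omega p -> {for p, continuous (fun q => jacobian_matrix f q i j)}.
  move=> /OmegaU /f_C1[_ cJp].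
  exact: (continuous_comp (g := fun M : 'M[R]_n => M i j) cJp (@coord_continuous _ _ _ _ _ _)).
have bounded (V : normedModType R) (g : 'rV[R]_n -> V) :
    (forall p, Omega p -> {for p, continuous g}) ->
    exists2 M : R, 0 <= M & forall p, Omega p -> `|g p| <= M.
  move=> cg; have cgO : {within Omega, continuous g}.
    by apply: continuous_in_subspaceT => p; rewrite inE; exact: cg.
  have [M [_ gM]] := compact_bounded (continuous_compact cgO Omega_compact).
  exists (`|M| + 1); first by rewrite addr_ge0.
  move=> p Op; apply: gM; last by exists p.
  by rewrite ltr_pwDr // ler_norm.
have [B _ xB] : exists2 M : R, 0 <= M & forall p, Omega p -> `|p| <= M.
  by apply: (bounded _ id) => p _; exact: cvg_id.
have [L _ fL] := bounded _ f (fun p Op => differentiable_continuous (df _ Op)).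
have [K K0 JK] := bounded _ (jacobian_matrix f) (fun p Op => (f_C1 _ (OmegaU _ Op)).2).
have dxi (i : 'I_n) (t : R) : 0 < t -> is_derive t (1 : R) (fun s => x s 0 i) (f (x t) 0 i).
  by move=> t0; apply: is_derive_coord; exact: dx.
have dyi (i : 'I_n) (t : R) : 0 < t -> is_derive t (1 : R) (fun s => f (x s) 0 i)
    (\sum_j jacobian_matrix f (x t) i j * f (x t) 0 j).
  by move=> t0; apply: is_derive_vector_field; [exact: dx|apply/df/Ox/ltW].
have xL : forall s t, 0 < s -> s <= t -> `|x t - x s| <= L * (t - s).
  exact: (lipschitz_ray dx (fun t t0 => fL _ (Ox _ (ltW t0)))).
(* The first index is quantified, since ['I_n] is empty for [n = 0]. *)
have x_head (i : 'I_n) : i = 0 :> nat -> exists c : R, x t 0 i @[t --> +oo] --> c.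
  move=> i0.
  have [|||b [T T0 yT]] := @head_eventually_signed R n K
    (fun t => jacobian_matrix f (x t)) (fun t j => f (x t) 0 j) i i0.
  - by move=> t t0; apply/f_jac/Ox/ltW.
  - exact: K0.
  - move=> t j l t0; apply: le_trans (JK _ (Ox _ (ltW t0))).
    rewrite [leRHS]/Num.Def.normr /= mx_normrE.
    exact: (le_bigmax _ (fun jl : 'I_n * 'I_n =>
      `|jacobian_matrix f (x t) jl.1 jl.2|) (j, l)).
  have dg (t : R) : 0 < t -> is_derive t (1 : R) (fun s => (-1) ^+ b * x s 0 i)
      ((-1) ^+ b * f (x t) 0 i).
    by move=> t0; have dxt := dxi i t t0; exact: is_deriveZ.
  have gB (t : R) : 0 < t -> (-1) ^+ b * x t 0 i <= B.
    move=> t0; apply: le_trans (ler_norm _) _; rewrite normrMsign.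
    exact: le_trans (ler_norm_coord _ _) (xB _ (Ox _ (ltW t0))).
  have [c gc] := nondecreasing_bounded_cvg dg yT gB T0.
  exists ((-1) ^+ b * c).
  have -> : (fun t => x t 0 i) = (fun t => (-1) ^+ b * ((-1) ^+ b * x t 0 i)).
    by apply/funext => t; rewrite signrMK.
  by apply: cvgM gc; exact: cvg_cst.
have nearO : \forall t \near +oo, Omega (x t).
  by near=> t; apply: Ox; near: t; exact: nbhs_pinfty_ge.
pose clus := cluster (x t @[t --> +oo]).
(* All cluster points are treated together: the step needs a component of [f] to tend to [0] along
   [x], which takes its vanishing at every one of them. *)
have f_clus k : forall i : 'I_n, (i <= k)%N -> forall p, Omega p -> clus p -> f p 0 i = 0.
  elim: k => [|k IH] i.
    rewrite leqn0 => /eqP i0 p Op xp; have [c xc] := x_head i i0.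
    exact: (cluster_derivative_eq0 (phi := fun q => f q 0 i) xL (dxi i) xc (cf _ _ Op) xp).
  rewrite leq_eqVlt => /predU1P[ik|]; last exact: IH.
  have kn : (k < n)%N by apply: ltn_trans (ltn_ord i); rewrite ik.
  move=> p Op xp; pose i' := Ordinal kn.
  have y0 : f (x t) 0 i' @[t --> +oo] --> (0 : R).
    apply: (@cluster_cvg _ 'rV[R]_n R _ _ x _ (fun q => f q 0 i') 0
      Omega_compact nearO) => q Oq xq.
    by split; [apply: IH|exact: cf].
  apply: (Mplus_next_eq0 (v := fun j => f p 0 j) (f_jac _ Op) (i := i')) => //.
    (* Component [k] of [f] along [x] converges, so its derivative, row [k] of [J f], vanishes at
       [p]. *)
    apply: (cluster_derivative_eq0
      (phi := fun q => \sum_j jacobian_matrix f q i' j * f q 0 j) xL (dyi i') y0 _ xp).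
    have add_cont : continuous (fun z : R * R => z.1 + z.2) by exact: add_continuous.
    apply: (cvg_big add_cont (nbhs_filter p)) => j _.
    by apply: cvgM; [exact: cJ|exact: cf].
  by move=> l lk; exact: IH.
have fclus0 p : Omega p -> clus p -> f p = 0.
  move=> Op xp; apply/rowP => i.
  by rewrite (f_clus n i (ltnW (ltn_ord i)) p Op xp) mxE.
have [e [Oe xe]] : Omega `&` clus !=set0 by exact: Omega_compact.
exists e; split=> //; first exact: fclus0.
(* With [psi = id], it remains to see that every cluster point [p] equals [e]: both are zeros of [f]
   with the same first coordinate. *)
apply: (@cluster_cvg _ 'rV[R]_n 'rV[R]_n _ _ x _ id e Omega_compact nearO) => p Op xp.
split; last exact: cvg_id.
apply: (Mplus_field_inj Omega_convex df f_jac Op Oe).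
  by rewrite !fclus0.
move=> i i0; have [c xc] := x_head i i0.
have clusE q : clus q -> q 0 i = c.
  move=> xq; apply: Rhausdorff => C D Cq Dc.
  have Dx : (x t @[t --> +oo]) [set v | D (v 0 i)] by exact: xc.
  have Cx : nbhs q [set v | C (v 0 i)] by exact: (coord_continuous (K := R) Cq).
  by have [v [Dv Cv]] := xq _ _ Dx Cx; exists (v 0 i).
by rewrite !clusE.
Unshelve. all: by end_near. Qed.
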